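(* Let $\sigma_a^\star=\inf_{\mathbf x\in\Omega_{\mathbf x},\,\mu\in\mathcal P}\sigma_a(\mathbf x;\mu)$. If $\sigma_a^\star>0$, then for every $\mu\in\mathcal P$, with $f_h(\cdot;\mu)$ the full order solution and $f_{RB}^m(\cdot;\mu)$ the reduced solution, $$\|f_h(\cdot;\mu)-f_{RB}^m(\cdot;\mu)\|_h\le\frac{1}{\sigma_a^\star}\,\|r_{h,\mu}(f_{RB}^m(\cdot;\mu))\|_h=\frac{\Delta_m^{(R)}(\mu)}{\sigma_a^\star}.$$
   Context: Problem. $\mathcal P\subset\mathbb R^d$ is a compact parameter set. The parametric steady-state radiative transfer equation is $\mathbf v\cdot\nabla_{\mathbf x}f+\sigma_t(\mathbf x;\mu)f=\sigma_s(\mathbf x;\mu)\rho+G(\mathbf x;\mu)$ on $\Omega_{\mathbf x}\times\mathbb S^{d_{\mathbf v}-1}$, with $\rho$ the angular average of $f$, inflow data $f=f_{in}(\mathbf x,\mathbf v;\mu)$ where $\mathbf v\cdot\mathbf n(\mathbf x)<0$ on $\partial\Omega_{\mathbf x}$, scattering and absorption cross sections $\sigma_s\ge0$, $\sigma_a\ge0$, and $\sigma_t=\sigma_s+\sigma_a>0$ (all data regular enough that the integrals below are finite). Discretization. $\Omega_{\mathbf x}=[x_L,x_R]\times[y_L,y_R]$ is partitioned into a Cartesian mesh $\mathcal T_h$ with edge set $\mathcal E_h$. $\{\mathbf v_j\}_{j=1}^{N_{\mathbf v}}$ are angular quadrature points on the unit sphere with weights $\omega_j>0$, $\sum_j\omega_j=1$.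 $\hat U_h^K=\{u:u|_T\in Q^K(T)\ \forall T\in\mathcal T_h\}$, where $Q^K(T)$ is the set of polynomials of degree at most $K$ in each variable; $U_h=\{g_h=(g_{h,1},\dots,g_{h,N_{\mathbf v}}):g_{h,j}\in\hat U_h^K\}$. Norm: $\|g_h\|_h=(\sum_j\omega_j\|g_{h,j}\|_{L_2(\Omega_{\mathbf x})}^2)^{1/2}$ with associated inner product $(\cdot,\cdot)_h$. $\mathcal E_{h,j}^-$ (resp. $\mathcal E_{h,j}^+$) is the set of edges $\mathbf e\subset\partial\Omega_{\mathbf x}$ with $\mathbf v_j\cdot\mathbf n_{\mathbf e}<0$ (resp. $\ge0$), $\mathbf n_{\mathbf e}$ the outward unit normal of $\Omega_{\mathbf x}$. For an edge $\mathbf e\subset\partial T$, $\mathbf n_{\mathbf e,T}$ is the outward unit normal of $T$; $\partial T_j^-=\{\mathbf e\subset\partial T:\mathbf v_j\cdot\mathbf n_{\mathbf e,T}<0\}$; $\phi|_T$ on $\mathbf e$ is the trace from $T$. For $f_h,\phi_h\in U_h$ and $\rho_h=\sum_k\omega_kf_{h,k}$, $$a_{h,\mu}(f_h,\phi_h)=\sum_j\omega_j\Big\{\sum_{T}\int_T\big(-(\mathbf v_j\cdot\nabla\phi_{h,j})f_{h,j}+\sigma_t\phi_{h,j}f_{h,j}\big)d\mathbf x+\sum_{\mathbf e\in\mathcal E_{h,j}^+}\int_{\mathbf e}\mathbf v_j\cdot\mathbf n_{\mathbf e}\,\phi_{h,j}f_{h,j}ds$$ $$-\sum_T\ \sum_{\mathbf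 e=T\cap T'\subset\partial T_j^-\setminus\mathcal E_{h,j}^-}\int_{\mathbf e}\mathbf v_j\cdot\mathbf n_{\mathbf e,T}(\phi_{h,j}|_{T'}-\phi_{h,j}|_T)f_{h,j}|_{T'}ds-\sum_T\int_T\sigma_s\rho_h\phi_{h,j}d\mathbf x\Big\},$$ $$l_{h,\mu}(\phi_h)=\sum_j\omega_j\Big\{\sum_T\int_TG\phi_{h,j}d\mathbf x-\sum_{\mathbf e\in\mathcal E_{h,j}^-}\int_{\mathbf e}f_{in}(\cdot,\mathbf v_j;\mu)\,\mathbf v_j\cdot\mathbf n_{\mathbf e}\,\phi_{h,j}ds\Big\},$$ with $\sigma_t,\sigma_s,G$ evaluated at parameter $\mu$. Full order solution: $f_h(\cdot;\mu)\in U_h$ with $a_{h,\mu}(f_h(\cdot;\mu),\phi_h)=l_{h,\mu}(\phi_h)$ for all $\phi_h\in U_h$. Residual of $g_h\in U_h$: the element $r_{h,\mu}(g_h)\in U_h$ with $(r_{h,\mu}(g_h),\hat g_h)_h=a_{h,\mu}(g_h,\hat g_h)-l_{h,\mu}(\hat g_h)$ for all $\hat g_h\in U_h$. Reduced solution: $U_{RB}^m=\mathrm{span}\{f_h(\cdot;\mu_1),\dots,f_h(\cdot;\mu_m)\}$ for selected parameters $\mu_1,\dots,\mu_m\in\mathcal P$ (with linearly independent snapshots). $f_{RB}^m(\cdot;\mu)\in U_{RB}^m$ is computed by either one of two reduced solvers: the Galerkin projection, $a_{h,\mu}(f_{RB}^m(\cdot;\mu),\phi_h)=l_{h,\mu}(\phi_h)$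 for all $\phi_h\in U_{RB}^m$; or the least-squares Petrov-Galerkin projection, $f_{RB}^m(\cdot;\mu)=\operatorname{argmin}_{g_h\in U_{RB}^m}\|r_{h,\mu}(g_h)\|_h$. The residual-based error indicator is $\Delta_m^{(R)}(\mu):=\|r_{h,\mu}(f_{RB}^m(\cdot;\mu))\|_h$. *)

(* Defs.v *)
From HB Require Import structures.
From mathcomp Require Import all_boot all_order all_algebra.
From mathcomp Require Import all_classical all_reals all_analysis.

Set Implicit Arguments.
Unset Strict Implicit.
Unset Printing Implicit Defensive.

Import Order.TTheory GRing.Theory Num.Theory.
Import numFieldNormedType.Exports.
Local Open Scope classical_set_scope.
Local Open Scope ring_scope.

(* The tensor mesh with nodes xL = x_0 < .. < x_nx = xR and
   yL = y_0 < .. < y_ny = yR; the values of xnode (ynode) beyond nx (ny) are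
   never used. *)
Record mesh (R : realType) := Mesh {
  xL : R; xR : R; yL : R; yR : R;
  nx : nat; ny : nat;
  xnode : nat -> R; ynode : nat -> R;
  nx_gt0 : (0 < nx)%N;
  ny_gt0 : (0 < ny)%N;
  xnode0 : xnode 0 = xL;
  xnodeN : xnode nx = xR;
  ynode0 : ynode 0 = yL;
  ynodeN : ynode ny = yR;
  xnode_lt : forall i, (i < nx)%N -> xnode i < xnode i.+1;
  ynode_lt : forall i, (i < ny)%N -> ynode i < ynode i.+1 }.

Definition domain (R : realType) (M : mesh R) : set (R * R) :=
  `[xL M, xR M]%classic `*` `[yL M, yR M]%classic.

Notation cell M := ('I_(nx M) * 'I_(ny M))%type.

Definition cell_set (R : realType) (M : mesh R) (T : cell M) : set (R * R) :=
  `[xnode M T.1, xnode M T.1.+1]%classic `*`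
  `[ynode M T.2, ynode M T.2.+1]%classic.

(* Edges are addressed as a side of a cell.  An edge of the boundary of the
   domain is thus represented exactly once, and an interior edge twice, once
   from each of the two cells sharing it. *)
Inductive side := West | East | South | North.

Definition side_code (s : side) : bool * bool :=
  match s with
  | West => (false, false) | East => (false, true)
  | South => (true, false) | North => (true, true)
  end.
Definition side_decode (b : bool * bool) : side :=
  match b with
  | (false, false) => West | (false, true) => East
  | (true, false) => South | (true, true) => North
  end.
Lemma side_codeK : cancel side_code side_decode. Proof. by case. Qed.
HB.instance Definition _ := Finite.copy side (can_type side_codeK).

Definition normal (R : realType) (s : side) : R * R :=
  match s with
  | West => (-1, 0) | East => (1, 0) | South => (0, -1) | North => (0, 1)
  end.

(* The cell on the other side of an edge; None for an edge contained in the
   boundary of the domain. *)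
Definition neighbour (R : realType) (M : mesh R) (T : cell M) (s : side)
    : option (cell M) :=
  match s with
  | West => if (0 < T.1)%N then omap (fun i => (i, T.2)) (insub T.1.-1)
            else None
  | East => omap (fun i => (i, T.2)) (insub T.1.+1)
  | South => if (0 < T.2)%N then omap (fun k => (T.1, k)) (insub T.2.-1)
             else None
  | North => omap (fun k => (T.1, k)) (insub T.2.+1)
  end.

Definition boundary_edge (R : realType) (M : mesh R) (T : cell M) (s : side)
    : bool := neighbour T s == None.

(* Arc-length parametrization of an edge and its parameter interval. *)
Definition edge_point (R : realType) (M : mesh R) (T : cell M) (s : side)
    (t : R) : R * R :=
  match s with
  | West => (xnode M T.1, t)
  | East => (xnode M T.1.+1, t)
  | South => (t, ynode M T.2)
  | North => (t, ynode M T.2.+1)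
  end.

Definition edge_param (R : realType) (M : mesh R) (T : cell M) (s : side)
    : set R :=
  match s with
  | West | East => `[ynode M T.2, ynode M T.2.+1]%classic
  | South | North => `[xnode M T.1, xnode M T.1.+1]%classic
  end.

Notation lebesgue2 R := (@lebesgue_measure R \x @lebesgue_measure R)%E.

Definition cell_int (R : realType) (M : mesh R) (T : cell M)
    (F : R * R -> R) : R :=
  \int[lebesgue2 R]_(z in cell_set T) F z.

Definition edge_int (R : realType) (M : mesh R) (T : cell M) (s : side)
    (F : R * R -> R) : R :=
  \int[@lebesgue_measure R]_(t in edge_param T s) F (edge_point T s t).

(* Angular variable in the unit sphere of R^(dv+2), dv+2 >= 2. *)
Record quadrature (R : realType) (dv Nv : nat) := Quadrature {
  vnode : 'I_Nv -> 'rV[R]_dv.+2;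
  weight : 'I_Nv -> R;
  vnode_unit : forall j, \sum_k vnode j 0 k ^+ 2 = 1;
  weight_gt0 : forall j, 0 < weight j;
  weight_sum1 : \sum_j weight j = 1 }.

(* Products of an angular vector with a planar one (a gradient or a normal)
   only involve the first two components of the former. *)
Definition dot2 (R : realType) (dv : nat) (v : 'rV[R]_dv.+2) (w : R * R) : R :=
  v 0 0 * w.1 + v 0 1 * w.2.

(* Q^K is represented by coefficient matrices: c stands for
   \sum_(p, q <= K) c p q x^p y^q. *)
Definition qval (R : realType) (K : nat) (c : 'M[R]_K.+1) (z : R * R) : R :=
  \sum_(p < K.+1) \sum_(q < K.+1) c p q * z.1 ^+ p * z.2 ^+ q.

Definition gradient (R : realType) (f : R * R -> R) (z : R * R) : R * R :=
  (derive1 (fun t : R => f (t, z.2)) z.1,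
   derive1 (fun t : R => f (z.1, t)) z.2).

(* The broken space of piecewise Q^K functions.  A member is given by its
   restrictions to the cells, so that both traces on an interior edge are
   available. *)
Notation Uhat R M K := {ffun cell M -> 'M[R]_K.+1}.
Notation Uh R M K Nv := {ffun 'I_Nv -> Uhat R M K}.

Definition L2inner (R : realType) (M : mesh R) (K : nat) (u w : Uhat R M K) : R :=
  \sum_(T : cell M) cell_int T (fun z => qval (u T) z * qval (w T) z).

Definition hinner (R : realType) (M : mesh R) (K dv Nv : nat)
    (Q : quadrature R dv Nv) (f g : Uh R M K Nv) : R :=
  \sum_j weight Q j * L2inner (f j) (g j).

Definition hnorm (R : realType) (M : mesh R) (K dv Nv : nat)
    (Q : quadrature R dv Nv) (f : Uh R M K Nv) : R :=
  Num.sqrt (hinner Q f f).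

Record rte_data (R : realType) (d dv : nat) := RteData {
  sigma_s : R * R -> 'rV[R]_d.+1 -> R;
  sigma_a : R * R -> 'rV[R]_d.+1 -> R;
  source : R * R -> 'rV[R]_d.+1 -> R;
  inflow : R * R -> 'rV[R]_dv.+2 -> 'rV[R]_d.+1 -> R }.

Definition sigma_t (R : realType) (d dv : nat) (D : rte_data R d dv)
    (z : R * R) (mu : 'rV[R]_d.+1) : R :=
  sigma_s D z mu + sigma_a D z mu.

(* Since elements of Uh are bounded on the domain and the constants belong to
   Uh, the integrability conditions amount to the finiteness of all the
   integrals in the discrete forms below. *)
Record admissible (R : realType) (d dv Nv : nat) (M : mesh R)
    (Q : quadrature R dv Nv) (P : set 'rV[R]_d.+1) (D : rte_data R d dv)
    : Prop := Admissible {
  sigma_s_ge0 : forall z mu, domain M z -> P mu -> 0 <= sigma_s D z mu;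
  sigma_a_ge0 : forall z mu, domain M z -> P mu -> 0 <= sigma_a D z mu;
  sigma_t_gt0 : forall z mu, domain M z -> P mu -> 0 < sigma_t D z mu;
  sigma_s_int : forall mu, P mu ->
    (lebesgue2 R).-integrable (domain M) (EFin \o (fun z => sigma_s D z mu));
  sigma_a_int : forall mu, P mu ->
    (lebesgue2 R).-integrable (domain M) (EFin \o (fun z => sigma_a D z mu));
  source_int : forall mu, P mu ->
    (lebesgue2 R).-integrable (domain M) (EFin \o (fun z => source D z mu));
  inflow_int : forall mu (j : 'I_Nv) (T : cell M) (s : side), P mu ->
    boundary_edge T s -> dot2 (vnode Q j) (normal R s) < 0 ->
    (@lebesgue_measure R).-integrable (edge_param T s)
      (EFin \o (fun t => inflow D (edge_point T s t) (vnode Q j) mu)) }.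

Definition density (R : realType) (M : mesh R) (K dv Nv : nat)
    (Q : quadrature R dv Nv) (f : Uh R M K Nv) (T : cell M) (z : R * R) : R :=
  \sum_k weight Q k * qval (f k T) z.

Definition aform (R : realType) (d dv K Nv : nat) (M : mesh R)
    (Q : quadrature R dv Nv) (D : rte_data R d dv) (mu : 'rV[R]_d.+1)
    (f phi : Uh R M K Nv) : R :=
  \sum_j weight Q j *
   (\sum_(T : cell M) cell_int T (fun z =>
        - dot2 (vnode Q j) (gradient (qval (phi j T)) z) * qval (f j T) z
        + sigma_t D z mu * qval (phi j T) z * qval (f j T) z)
    + \sum_(T : cell M)
        \sum_(s | boundary_edge T s && (0 <= dot2 (vnode Q j) (normal R s)))
          edge_int T s (fun z =>
            dot2 (vnode Q j) (normal R s) * qval (phi j T) z * qval (f j T) z)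
    - \sum_(T : cell M)
        \sum_(s | dot2 (vnode Q j) (normal R s) < 0)
          \sum_(T' | neighbour T s == Some T')
            edge_int T s (fun z =>
              dot2 (vnode Q j) (normal R s)
              * (qval (phi j T') z - qval (phi j T) z) * qval (f j T') z)
    - \sum_(T : cell M) cell_int T (fun z =>
        sigma_s D z mu * density Q f T z * qval (phi j T) z)).

Definition lform (R : realType) (d dv K Nv : nat) (M : mesh R)
    (Q : quadrature R dv Nv) (D : rte_data R d dv) (mu : 'rV[R]_d.+1)
    (phi : Uh R M K Nv) : R :=
  \sum_j weight Q j *
   (\sum_(T : cell M) cell_int T (fun z => source D z mu * qval (phi j T) z)
    - \sum_(T : cell M)
        \sum_(s | boundary_edge T s && (dot2 (vnode Q j) (normal R s) < 0))
          edge_int T s (fun z =>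
            inflow D z (vnode Q j) mu * dot2 (vnode Q j) (normal R s)
            * qval (phi j T) z)).

Definition full_order_solution (R : realType) (d dv K Nv : nat) (M : mesh R)
    (Q : quadrature R dv Nv) (D : rte_data R d dv) (mu : 'rV[R]_d.+1)
    (f : Uh R M K Nv) : Prop :=
  forall phi : Uh R M K Nv, aform Q D mu f phi = lform Q D mu phi.

Definition is_residual (R : realType) (d dv K Nv : nat) (M : mesh R)
    (Q : quadrature R dv Nv) (D : rte_data R d dv) (mu : 'rV[R]_d.+1)
    (g r : Uh R M K Nv) : Prop :=
  forall ghat : Uh R M K Nv,
    hinner Q r ghat = aform Q D mu g ghat - lform Q D mu ghat.

Definition galerkin_solution (R : realType) (d dv K Nv : nat) (M : mesh R)
    (Q : quadrature R dv Nv) (D : rte_data R d dv) (mu : 'rV[R]_d.+1)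
    (U : {vspace Uh R M K Nv}) (f : Uh R M K Nv) : Prop :=
  f \in U /\
  forall phi : Uh R M K Nv, phi \in U -> aform Q D mu f phi = lform Q D mu phi.

(* r is the residual map at the parameter under consideration. *)
Definition lspg_solution (R : realType) (dv K Nv : nat) (M : mesh R)
    (Q : quadrature R dv Nv) (r : Uh R M K Nv -> Uh R M K Nv)
    (U : {vspace Uh R M K Nv}) (f : Uh R M K Nv) : Prop :=
  f \in U /\
  forall g : Uh R M K Nv, g \in U -> hnorm Q (r f) <= hnorm Q (r g).

Definition error_indicator (R : realType) (dv K Nv : nat) (M : mesh R)
    (Q : quadrature R dv Nv) (r : Uh R M K Nv -> Uh R M K Nv) (f : Uh R M K Nv) : R :=
  hnorm Q (r f).

Definition sigma_a_star (R : realType) (d dv : nat) (M : mesh R)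
    (P : set 'rV[R]_d.+1) (D : rte_data R d dv) : R :=
  inf [set sigma_a D z mu | z in domain M & mu in P].

(* Main.v *)
Require Import Defs.
From mathcomp Require Import all_boot all_order all_algebra.
From mathcomp Require Import all_classical all_reals all_analysis.
From mathcomp Require Import measurable_realfun ring lra.

Set Implicit Arguments.
Unset Strict Implicit.
Unset Printing Implicit Defensive.

Import Order.TTheory GRing.Theory Num.Theory.
Import numFieldNormedType.Exports.
Local Open Scope classical_set_scope.
Local Open Scope ring_scope.

(** The form [aform] is coercive with constant [sigma_a_star]: writing
    s = sigma_a_star and e = fRB - fh, one has s ||e||^2 <= a(e, e)
    ([aform_coercive]).  By linearity of [aform] in its first argument
    ([aformB]), the residual rho of fRB represents a(e, .), because fh solves
    a(fh, .) = l; hence s ||e||^2 <= (rho, e).  Expanding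
    0 <= ||rho - s e||^2 = ||rho||^2 - 2 s (rho, e) + s^2 ||e||^2 then gives
    s^2 ||e||^2 <= ||rho||^2, which is the claim.

    Coercivity has two independent sources.

    - For each direction, upwinding dissipates energy ([advection_energy]).
      Green's formula on a cell turns the volume term into
      -1/2 sum_s (v.n_s) int_s u^2.  An interior edge occurs once from each of
      its two cells, with opposite normals; collecting both contributions
      together with the upwind term leaves 1/2 |v.n| (jump of u)^2, and a
      boundary edge, on the inflow or on the outflow part, is left with
      1/2 |v.n| u^2.

    - Across the directions, the scattering gain never exceeds the scattering
      loss: the weights sum to one, so Jensen's inequality bounds the square
      of the angular mean by the mean of the squares ([density_sqr_le]), and
      sigma_t - sigma_s = sigma_a >= s remains ([collision_ge]).

    Linearity and these computations are manipulations of integrals, hence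
    depend on integrability; it is supplied by the class [tame] below, which
    contains the polynomials and multiplies integrable data into integrable
    functions. *)

(** * Integration of tame functions over rectangles *)

Section Tame.
Variable R : realType.
Implicit Types (F G : R * R -> R) (a b c d k : R).

(** Unlike continuity, these two properties pass directly to products with
    merely integrable functions, and need no comparison of the Borel sets of
    the plane with the product sigma-algebra. *)
Definition tame F := measurable_fun setT F /\
  forall B, exists C, forall z, `|z.1| <= B -> `|z.2| <= B -> `|F z| <= C.

Lemma tame_cst k : tame (fun=> k).
Proof. by split=> [|B]; [exact: measurable_cst | exists `|k|]. Qed.

Lemma tame_fst : tame fst.
Proof. by split=> [|B]; [exact: measurable_fst | exists B]. Qed.

Lemma tame_snd : tame snd.
Proof. by split=> [|B]; [exact: measurable_snd | exists B]. Qed.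

Lemma tameD F G : tame F -> tame G -> tame (fun z => F z + G z).
Proof.
move=> [mF bF] [mG bG]; split=> [|B]; first exact: measurable_funD.
have [CF hF] := bF B; have [CG hG] := bG B; exists (CF + CG) => z z1 z2.
by rewrite (le_trans (ler_normD _ _))// lerD ?hF ?hG.
Qed.

Lemma tameM F G : tame F -> tame G -> tame (fun z => F z * G z).
Proof.
move=> [mF bF] [mG bG]; split=> [|B]; first exact: measurable_funM.
have [CF hF] := bF B; have [CG hG] := bG B; exists (CF * CG) => z z1 z2.
by rewrite normrM ler_pM ?hF ?hG.
Qed.

Lemma tameN F : tame F -> tame (fun z => - F z).
Proof.
move=> tF; under eq_fun do rewrite -mulN1r.
by apply: tameM => //; exact: tame_cst.
Qed.

Lemma tameB F G : tame F -> tame G -> tame (fun z => F z - G z).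
Proof. by move=> tF tG; apply: tameD => //; exact: tameN. Qed.

Lemma tameX F n : tame F -> tame (fun z => F z ^+ n).
Proof.
move=> tF; elim: n => [|n IH]; first exact: tame_cst.
by under eq_fun do rewrite exprS; exact: tameM.
Qed.

Lemma tame_sum I (r : seq I) (P : pred I) (F : I -> R * R -> R) :
  (forall i, tame (F i)) -> tame (fun z => \sum_(i <- r | P i) F i z).
Proof.
move=> tF; elim: r => [|i r IH].
  by under eq_fun do rewrite big_nil; exact: tame_cst.
under eq_fun do rewrite big_cons; case: (P i) => //.
exact: tameD.
Qed.

Lemma norm_itv a b t : t \in `[a, b] -> `|t| <= `|a| + `|b|.
Proof.
rewrite in_itv/= => /andP[at_ tb]; rewrite ler_norml; apply/andP; split.
  by have := ler_norm (- a); rewrite normrN => h; have := normr_ge0 b; lra.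
by have := ler_norm b; have := normr_ge0 a; lra.
Qed.

Lemma measurable_rect a b c d :
  measurable (`[a, b]%classic `*` `[c, d]%classic : set (R * R)).
Proof. by apply: measurableX; exact: measurable_itv. Qed.

Lemma lebesgue_itv_lty a b :
  ((@lebesgue_measure R) `[a, b]%classic < +oo)%E.
Proof. by rewrite lebesgue_measure_itv/=; case: ifP; rewrite -?EFinD ltry. Qed.

Lemma lebesgue2_rect_lty a b c d :
  ((lebesgue2 R) (`[a, b]%classic `*` `[c, d]%classic) < +oo)%E.
Proof.
rewrite product_measure1E; [|exact: measurable_itv..].
by rewrite lte_mul_pinfty//= ?lebesgue_itv_lty// lebesgue_measure_itv/=;
  case: ifP; rewrite -?EFinD.
Qed.

Lemma tame_bounded_rect a b c d F : tame F ->
  [bounded F z | z in `[a, b]%classic `*` `[c, d]%classic].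
Proof.
move=> [_ bF]; have [C hC] := bF ((`|a| + `|b|) + (`|c| + `|d|)).
exists C; split; first exact: num_real.
move=> C' CC' z [/= z1 z2]; apply: le_trans (ltW CC'); apply: hC.
  by rewrite (le_trans (norm_itv z1))// lerDl addr_ge0.
by rewrite (le_trans (norm_itv z2))// lerDr addr_ge0.
Qed.

Lemma tame_integrable_rect a b c d F : tame F ->
  (lebesgue2 R).-integrable (`[a, b]%classic `*` `[c, d]%classic) (EFin \o F).
Proof.
move=> tF; apply: measurable_bounded_integrable.
- exact: measurable_rect.
- exact: lebesgue2_rect_lty.
- exact: measurable_funTS tF.1.
- exact: tame_bounded_rect.
Qed.

(** The cross sections are only integrable, so that integrability of the
    weighted mass terms has to come from boundedness of the other factor. *)
Lemma integrable_mul_tame a b c d F G :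
    (lebesgue2 R).-integrable (`[a, b]%classic `*` `[c, d]%classic)
      (EFin \o F) -> tame G ->
  (lebesgue2 R).-integrable (`[a, b]%classic `*` `[c, d]%classic)
    (EFin \o (fun z => F z * G z)).
Proof.
move=> iF tG.
have -> : EFin \o (fun z => F z * G z) = ((EFin \o F) \* (EFin \o G))%E.
  by apply/funext => z /=; rewrite EFinM.
apply: integrableMl => //.
- exact: measurable_rect.
- exact: measurable_funTS tG.1.
- exact: tame_bounded_rect.
Qed.

Lemma tame_integrable_line a b F (g : R -> R * R) : tame F ->
    measurable_fun setT g ->
    (exists B, forall t, t \in `[a, b] -> `|(g t).1| <= B /\ `|(g t).2| <= B) ->
  (@lebesgue_measure R).-integrable `[a, b]%classic (EFin \o (F \o g)).
Proof.
move=> [mF bF] mg [B hB]; apply: measurable_bounded_integrable => //.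
- exact: lebesgue_itv_lty.
- exact/measurable_funTS/measurableT_comp.
- have [C hC] := bF B; exists C; split; first exact: num_real.
  move=> C' CC' t /= tab; have [h1 h2] := hB _ tab.
  by apply: le_trans (ltW CC'); exact: hC.
Qed.

Lemma tame_integrable_vline x c d F : tame F ->
  (@lebesgue_measure R).-integrable `[c, d]%classic (EFin \o (fun t => F (x, t))).
Proof.
move=> tF; apply: (@tame_integrable_line _ _ F (fun t => (x, t)) tF).
  exact: pair1_measurable.
exists (`|x| + (`|c| + `|d|)) => t /norm_itv tcd /=; rewrite lerDl addr_ge0//.
by split=> //; rewrite (le_trans tcd)// lerDr.
Qed.

Lemma tame_integrable_hline y a b F : tame F ->
  (@lebesgue_measure R).-integrable `[a, b]%classic (EFin \o (fun t => F (t, y))).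
Proof.
move=> tF; apply: (@tame_integrable_line _ _ F (fun t => (t, y)) tF).
  exact: pair2_measurable.
exists (`|y| + (`|a| + `|b|)) => t /norm_itv tab /=; rewrite lerDl addr_ge0//.
by split=> //; rewrite (le_trans tab)// lerDr.
Qed.

Lemma tame_integrable_patch a b c d F : tame F ->
  (lebesgue2 R).-integrable setT
    ((EFin \o F) \_ (`[a, b]%classic `*` `[c, d]%classic)).
Proof.
move=> tF.
have [h _] := @integrable_mkcond _ _ _ (lebesgue2 R) _ (EFin \o F)
  (measurable_rect a b c d).
exact/h/tame_integrable_rect.
Qed.

(** Fubini's theorem is applied to the extension by zero to the whole plane,
    whose sections vanish or are sections of the integrand extended by
    zero. *)
Lemma Rintegral_rect_yx a b c d F : tame F ->
  \int[lebesgue2 R]_(z in `[a, b]%classic `*` `[c, d]%classic) F z =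
  \int[lebesgue_measure]_(y in `[c, d])
    \int[lebesgue_measure]_(x in `[a, b]) F (x, y).
Proof.
move=> tF; rewrite {1}/Rintegral integral_mkcond -integral21_prod_meas1; last first.
  exact: tame_integrable_patch.
rewrite [RHS]/Rintegral [in RHS]integral_mkcond; congr fine.
apply: eq_integral => y _; rewrite /patch; case: ifPn => [yB|yB]; last first.
  by apply: integral0_eq => x _; rewrite in_setX/= (negbTE yB) andbF.
rewrite /Rintegral fineK; last first.
  exact/integrable_fin_num/tame_integrable_hline.
rewrite [RHS]integral_mkcond; apply: eq_integral => x _.
by rewrite in_setX/= yB andbT.
Qed.

Lemma Rintegral_rect_xy a b c d F : tame F ->
  \int[lebesgue2 R]_(z in `[a, b]%classic `*` `[c, d]%classic) F z =
  \int[lebesgue_measure]_(x in `[a, b])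
    \int[lebesgue_measure]_(y in `[c, d]) F (x, y).
Proof.
move=> tF; rewrite {1}/Rintegral integral_mkcond -integral12_prod_meas1; last first.
  exact: tame_integrable_patch.
rewrite [RHS]/Rintegral [in RHS]integral_mkcond; congr fine.
apply: eq_integral => x _; rewrite /patch; case: ifPn => [xA|xA]; last first.
  by apply: integral0_eq => y _; rewrite in_setX/= (negbTE xA).
rewrite /Rintegral fineK; last first.
  exact/integrable_fin_num/tame_integrable_vline.
rewrite [RHS]integral_mkcond; apply: eq_integral => y _.
by rewrite in_setX/= xA.
Qed.

(** [p^`() * p] is the derivative of [p ^+ 2 / 2]. *)
Lemma Rintegral_deriv_mul (p : {poly R}) a b : a < b ->
  \int[lebesgue_measure]_(t in `[a, b]) (derive1 (horner p) t * p.[t]) =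
  2^-1 * p.[b] ^+ 2 - 2^-1 * p.[a] ^+ 2.
Proof.
move=> ab; rewrite -derivE.
have -> : (fun t => p^`().[t] * p.[t]) = horner (p^`() * p).
  by apply/funext => t; rewrite hornerM.
pose q := 2^-1 *: (p ^+ 2).
have dq : q^`() = p^`() * p.
  rewrite derivZ expr2 derivM [p * _]mulrC -mulr2n -scalerMnr scalerMnl.
  by rewrite -mulr_natr mulVf ?scale1r// pnatr_eq0.
rewrite /Rintegral (@continuous_FTC2 _ _ (horner q)).
- by rewrite -EFinB/= /q !hornerZ !horner_exp.
- exact: ab.
- by apply: continuous_subspaceT => t; exact: continuous_horner.
- split=> [t _| |].
  + exact: derivable_horner.
  + by apply: cvg_at_right_filter; exact: continuous_horner.
  + by apply: cvg_at_left_filter; exact: continuous_horner.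
- by move=> t _; rewrite -derivE dq.
Qed.

End Tame.

(** * Elements of Q^K on a cell *)

Section Polynomials.
Variables (R : realType) (K : nat).
Implicit Types (c : 'M[R]_K.+1) (x y t : R) (z : R * R).

Lemma qvalB c1 c2 z : qval (c1 - c2) z = qval c1 z - qval c2 z.
Proof.
rewrite /qval -sumrB; apply: eq_bigr => p _; rewrite -sumrB.
by apply: eq_bigr => q _; rewrite !mxE !mulrBl.
Qed.

Lemma qvalZ (a : R) c z : qval (a *: c) z = a * qval c z.
Proof.
rewrite /qval mulr_sumr; apply: eq_bigr => p _; rewrite mulr_sumr.
by apply: eq_bigr => q _; rewrite !mxE !mulrA.
Qed.

Lemma tame_qval c : tame (qval c).
Proof.
apply: tame_sum => p; apply: tame_sum => q; apply: tameM.
  apply: tameM; first exact: tame_cst.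
  by apply: tameX; exact: tame_fst.
by apply: tameX; exact: tame_snd.
Qed.

(** Freezing one variable gives a univariate polynomial, so that partial
    derivatives of [qval c] become formal derivatives. *)
Definition xslice c y : {poly R} :=
  \sum_(p < K.+1) (\sum_(q < K.+1) c p q * y ^+ q) *: 'X^p.

Definition yslice c x : {poly R} :=
  \sum_(q < K.+1) (\sum_(p < K.+1) c p q * x ^+ p) *: 'X^q.

Lemma xsliceE c t y : qval c (t, y) = (xslice c y).[t].
Proof.
rewrite /qval /xslice horner_sum; apply: eq_bigr => p _ /=.
rewrite hornerZ hornerXn mulr_suml; apply: eq_bigr => q _.
by rewrite mulrAC.
Qed.

Lemma ysliceE c x t : qval c (x, t) = (yslice c x).[t].
Proof.
rewrite /qval /yslice horner_sum exchange_big; apply: eq_bigr => q _ /=.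
by rewrite hornerZ hornerXn mulr_suml.
Qed.

Lemma gradient_xslice c z : (gradient (qval c) z).1 = (xslice c z.2)^`().[z.1].
Proof.
have e : (fun t => qval c (t, z.2)) = horner (xslice c z.2).
  by apply/funext => t; exact: xsliceE.
by rewrite /gradient e -derivE.
Qed.

Lemma gradient_yslice c z : (gradient (qval c) z).2 = (yslice c z.1)^`().[z.2].
Proof.
have e : (fun t => qval c (z.1, t)) = horner (yslice c z.1).
  by apply/funext => t; exact: ysliceE.
by rewrite /gradient e -derivE.
Qed.

Lemma tame_gradient1 c : tame (fun z => (gradient (qval c) z).1).
Proof.
have e z : (gradient (qval c) z).1 = \sum_(p < K.+1)
    (\sum_(q < K.+1) c p q * z.2 ^+ q) * (z.1 ^+ p.-1 * p%:R).
  rewrite gradient_xslice /xslice raddf_sum horner_sum; apply: eq_bigr => p _.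
  by rewrite /= derivZ derivXn hornerZ hornerMn hornerXn -mulr_natr.
rewrite (funext e); apply: tame_sum => p.
apply: tameM.
  apply: tame_sum => q; apply: tameM; first exact: tame_cst.
  by apply: tameX; exact: tame_snd.
by apply: tameM; [apply: tameX; exact: tame_fst | exact: tame_cst].
Qed.

Lemma tame_gradient2 c : tame (fun z => (gradient (qval c) z).2).
Proof.
have e z : (gradient (qval c) z).2 = \sum_(q < K.+1)
    (\sum_(p < K.+1) c p q * z.1 ^+ p) * (z.2 ^+ q.-1 * q%:R).
  rewrite gradient_yslice /yslice raddf_sum horner_sum; apply: eq_bigr => q _.
  by rewrite /= derivZ derivXn hornerZ hornerMn hornerXn -mulr_natr.
rewrite (funext e); apply: tame_sum => q.
apply: tameM.
  apply: tame_sum => p; apply: tameM; first exact: tame_cst.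
  by apply: tameX; exact: tame_fst.
by apply: tameM; [apply: tameX; exact: tame_snd | exact: tame_cst].
Qed.

Lemma tame_dot2_gradient dv (v : 'rV[R]_dv.+2) c :
  tame (fun z => dot2 v (gradient (qval c) z)).
Proof.
by apply: tameD; apply: tameM;
  [exact: tame_cst|exact: tame_gradient1|exact: tame_cst|exact: tame_gradient2].
Qed.

End Polynomials.

(** * Cell and edge integrals, Green's formula *)

Section CellCalculus.
Variables (R : realType) (M : mesh R).
Implicit Types (T : cell M) (s : side) (F G : R * R -> R) (k : R).

Definition cell_integrable T F :=
  (lebesgue2 R).-integrable (cell_set T) (EFin \o F).

Lemma measurable_cell T : measurable (cell_set T).
Proof. exact: measurable_rect. Qed.

Lemma cell_integrable_tame T F : tame F -> cell_integrable T F.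
Proof. exact: tame_integrable_rect. Qed.

Lemma cell_integrableM T F G :
  cell_integrable T F -> tame G -> cell_integrable T (fun z => F z * G z).
Proof. exact: integrable_mul_tame. Qed.

Lemma cell_integrableD T F G : cell_integrable T F -> cell_integrable T G ->
  cell_integrable T (fun z => F z + G z).
Proof.
move=> iF iG; rewrite /cell_integrable.
have -> : EFin \o (fun z => F z + G z) = ((EFin \o F) \+ (EFin \o G))%E by [].
by apply: integrableD => //; exact: measurable_cell.
Qed.

Lemma cell_integrableZ T F k :
  cell_integrable T F -> cell_integrable T (fun z => k * F z).
Proof.
move=> iF; under eq_fun do rewrite mulrC.
by apply: cell_integrableM => //; exact: tame_cst.
Qed.

Lemma cell_integrableB T F G : cell_integrable T F -> cell_integrable T G ->
  cell_integrable T (fun z => F z - G z).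
Proof.
move=> iF iG; apply: cell_integrableD => //.
by under eq_fun do rewrite -mulN1r; exact: cell_integrableZ.
Qed.

Lemma cell_intD T F G : cell_integrable T F -> cell_integrable T G ->
  cell_int T (fun z => F z + G z) = cell_int T F + cell_int T G.
Proof. by move=> iF iG; apply: RintegralD => //; exact: measurable_cell. Qed.

Lemma cell_intB T F G : cell_integrable T F -> cell_integrable T G ->
  cell_int T (fun z => F z - G z) = cell_int T F - cell_int T G.
Proof. by move=> iF iG; apply: RintegralB => //; exact: measurable_cell. Qed.

Lemma cell_intZ T F k : cell_integrable T F ->
  cell_int T (fun z => k * F z) = k * cell_int T F.
Proof. by move=> iF; apply: RintegralZl => //; exact: measurable_cell. Qed.

Lemma cell_int_ge0 T F : (forall z, cell_set T z -> 0 <= F z) ->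
  0 <= cell_int T F.
Proof. by move=> F0; apply: Rintegral_ge0 => z; exact: F0. Qed.

Lemma edge_integrable T s F : tame F ->
  (@lebesgue_measure R).-integrable (edge_param T s)
    (EFin \o (fun t => F (edge_point T s t))).
Proof.
by case: s => tF; [exact: tame_integrable_vline|exact: tame_integrable_vline|
  exact: tame_integrable_hline|exact: tame_integrable_hline].
Qed.

Lemma measurable_edge T s : measurable (edge_param T s : set R).
Proof. by case: s; exact: measurable_itv. Qed.

Lemma edge_intD T s F G : tame F -> tame G ->
  edge_int T s (fun z => F z + G z) = edge_int T s F + edge_int T s G.
Proof.
move=> tF tG; apply: RintegralD; first exact: measurable_edge.
  exact: edge_integrable.
exact: edge_integrable.
Qed.

Lemma edge_intB T s F G : tame F -> tame G ->
  edge_int T s (fun z => F z - G z) = edge_int T s F - edge_int T s G.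
Proof.
move=> tF tG; apply: RintegralB; first exact: measurable_edge.
  exact: edge_integrable.
exact: edge_integrable.
Qed.

Lemma edge_intZ T s F k : tame F ->
  edge_int T s (fun z => k * F z) = k * edge_int T s F.
Proof.
move=> tF; apply: RintegralZl; first exact: measurable_edge.
exact: edge_integrable.
Qed.

Lemma edge_int_ge0 T s F : (forall z, 0 <= F z) -> 0 <= edge_int T s F.
Proof. by move=> F0; apply: Rintegral_ge0 => t _. Qed.

Lemma xnode_mono (i k : nat) : (i <= k <= nx M)%N -> xnode M i <= xnode M k.
Proof.
move=> /andP[]; elim: k => [|k IH]; first by rewrite leqn0 => /eqP ->.
rewrite leq_eqVlt => /predU1P[->//|ik] kn.
by rewrite (le_trans (IH ik (ltnW kn)))// ltW// xnode_lt.
Qed.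

Lemma ynode_mono (i k : nat) : (i <= k <= ny M)%N -> ynode M i <= ynode M k.
Proof.
move=> /andP[]; elim: k => [|k IH]; first by rewrite leqn0 => /eqP ->.
rewrite leq_eqVlt => /predU1P[->//|ik] kn.
by rewrite (le_trans (IH ik (ltnW kn)))// ltW// ynode_lt.
Qed.

Lemma cell_sub_domain T : cell_set T `<=` domain M.
Proof.
case: T => i k [x y] [/=]; rewrite !in_itv/= => /andP[x1 x2] /andP[y1 y2].
split=> /=; rewrite in_itv/=; apply/andP; split.
- by rewrite -xnode0 (le_trans _ x1)// xnode_mono//= ltnW.
- by rewrite -xnodeN (le_trans x2)// xnode_mono// leqnn ltn_ord.
- by rewrite -ynode0 (le_trans _ y1)// ynode_mono//= ltnW.
- by rewrite -ynodeN (le_trans y2)// ynode_mono// leqnn ltn_ord.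
Qed.

Lemma cell_integrable_domain T F :
  (lebesgue2 R).-integrable (domain M) (EFin \o F) -> cell_integrable T F.
Proof.
apply: integrableS; [exact: measurable_rect|exact: measurable_cell|].
exact: cell_sub_domain.
Qed.

(** Integrate along x first: the inner integral is exact by the fundamental
    theorem of calculus, and the two remaining line integrals run over the
    East and West sides.  [Green2] is the same with the other order of
    integration. *)
Lemma Green1 K (c : 'M[R]_K.+1) T :
  cell_int T (fun z => (gradient (qval c) z).1 * qval c z) =
  2^-1 * edge_int T East (fun z => qval c z ^+ 2)
  - 2^-1 * edge_int T West (fun z => qval c z ^+ 2).
Proof.
have tq : tame (fun z => qval c z ^+ 2) by apply: tameX; exact: tame_qval.
have tp : tame (fun z => 2^-1 * qval c z ^+ 2) by apply: tameM => //; exact: tame_cst.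
rewrite -!edge_intZ//.
rewrite {1}/cell_int Rintegral_rect_yx; last first.
  by apply: tameM; [exact: tame_gradient1|exact: tame_qval].
rewrite -RintegralB; [|exact: measurable_itv|
  exact: (edge_integrable T East tp)|exact: (edge_integrable T West tp)].
apply: eq_Rintegral => y _.
have -> : (fun x => (gradient (qval c) (x, y)).1 * qval c (x, y)) =
    (fun x => derive1 (horner (xslice c y)) x * (xslice c y).[x]).
  by apply/funext => x; rewrite gradient_xslice/= xsliceE -derivE.
by rewrite Rintegral_deriv_mul ?xnode_lt ?ltn_ord//= !xsliceE.
Qed.

Lemma Green2 K (c : 'M[R]_K.+1) T :
  cell_int T (fun z => (gradient (qval c) z).2 * qval c z) =
  2^-1 * edge_int T North (fun z => qval c z ^+ 2)
  - 2^-1 * edge_int T South (fun z => qval c z ^+ 2).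
Proof.
have tq : tame (fun z => qval c z ^+ 2) by apply: tameX; exact: tame_qval.
have tp : tame (fun z => 2^-1 * qval c z ^+ 2) by apply: tameM => //; exact: tame_cst.
rewrite -!edge_intZ//.
rewrite {1}/cell_int Rintegral_rect_xy; last first.
  by apply: tameM; [exact: tame_gradient2|exact: tame_qval].
rewrite -RintegralB; [|exact: measurable_itv|
  exact: (edge_integrable T North tp)|exact: (edge_integrable T South tp)].
apply: eq_Rintegral => x _.
have -> : (fun y => (gradient (qval c) (x, y)).2 * qval c (x, y)) =
    (fun y => derive1 (horner (yslice c x)) y * (yslice c x).[y]).
  by apply/funext => y; rewrite gradient_yslice/= ysliceE -derivE.
by rewrite Rintegral_deriv_mul ?ynode_lt ?ltn_ord//= !ysliceE.
Qed.

Lemma side_sum (V : zmodType) (f : side -> V) :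
  \sum_s f s = f West + f East + f South + f North.
Proof.
rewrite (bigD1 West)//= (bigD1 East)//= (bigD1 South)//= (bigD1 North)//=.
by rewrite big1 ?addr0 ?addrA//; case.
Qed.

Lemma Green K dv (v : 'rV[R]_dv.+2) (c : 'M[R]_K.+1) T :
  cell_int T (fun z => - dot2 v (gradient (qval c) z) * qval c z) =
  - \sum_s 2^-1 * dot2 v (normal R s) * edge_int T s (fun z => qval c z ^+ 2).
Proof.
have tG1 : tame (fun z => (gradient (qval c) z).1 * qval c z).
  by apply: tameM; [exact: tame_gradient1|exact: tame_qval].
have tG2 : tame (fun z => (gradient (qval c) z).2 * qval c z).
  by apply: tameM; [exact: tame_gradient2|exact: tame_qval].
have -> : (fun z => - dot2 v (gradient (qval c) z) * qval c z) =
    (fun z => - v 0 0 * ((gradient (qval c) z).1 * qval c z)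
              + - v 0 1 * ((gradient (qval c) z).2 * qval c z)).
  by apply/funext => z; rewrite /dot2; ring.
rewrite cell_intD ?cell_intZ; try (by apply: cell_integrable_tame).
- rewrite Green1 Green2 side_sum /dot2/=; ring.
- by apply: cell_integrable_tame; apply: tameM => //; exact: tame_cst.
- by apply: cell_integrable_tame; apply: tameM => //; exact: tame_cst.
Qed.

End CellCalculus.

(** * Interior edges seen from both sides *)

Section Pairing.
Variables (R : realType) (M : mesh R).
Implicit Types (T : cell M) (s : side) (F G : R * R -> R).

Definition opposite s : side :=
  match s with West => East | East => West | South => North | North => South end.

Lemma oppositeK : involutive opposite. Proof. by case. Qed.

Lemma dot2_opposite dv (v : 'rV[R]_dv.+2) s :
  dot2 v (normal R (opposite s)) = - dot2 v (normal R s).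
Proof. by case: s; rewrite /dot2 /=; ring. Qed.

Lemma omap_insub_eq n (A : eqType) (f : 'I_n -> A) (m : nat) (y : A) :
  (omap f (insub m) == Some y) = [exists i : 'I_n, (i == m :> nat) && (f i == y)].
Proof.
apply/eqP/existsP => [|[i /andP[/eqP im /eqP fy]]]; last first.
  by rewrite -im valK /= fy.
by case: insubP => //= i _ im [fy]; exists i; rewrite im fy !eqxx.
Qed.

Lemma neighbourE T s T' : (neighbour T s == Some T') =
  match s with
  | West => (T.1 == T'.1.+1 :> nat) && (T.2 == T'.2)
  | East => (T'.1 == T.1.+1 :> nat) && (T.2 == T'.2)
  | South => (T.2 == T'.2.+1 :> nat) && (T.1 == T'.1)
  | North => (T'.2 == T.2.+1 :> nat) && (T.1 == T'.1)
  end.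
Proof.
case: T T' => i k [i' k'] /=; case: s => /=.
- case: ifPn => [i0|]; last by rewrite -eqn0Ngt => /eqP ->.
  rewrite omap_insub_eq; apply/existsP/andP => [[x]|[/eqP e /eqP ->]].
    by rewrite xpair_eqE => /and3P[/eqP e /eqP <- ->]; rewrite e prednK.
  by exists i'; rewrite e/= !eqxx.
- rewrite omap_insub_eq; apply/existsP/andP => [[x]|[/eqP e /eqP ->]].
    by rewrite xpair_eqE => /and3P[/eqP e /eqP <- ->]; rewrite e.
  by exists i'; rewrite e/= !eqxx.
- case: ifPn => [k0|]; last by rewrite -eqn0Ngt => /eqP ->.
  rewrite omap_insub_eq; apply/existsP/andP => [[x]|[/eqP e /eqP ->]].
    by rewrite xpair_eqE => /and3P[/eqP e -> /eqP <-]; rewrite e prednK.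
  by exists k'; rewrite e/= !eqxx.
- rewrite omap_insub_eq; apply/existsP/andP => [[x]|[/eqP e /eqP ->]].
    by rewrite xpair_eqE => /and3P[/eqP e -> /eqP <-]; rewrite e.
  by exists k'; rewrite e/= !eqxx.
Qed.

Lemma neighbour_opposite T s T' :
  (neighbour T s == Some T') = (neighbour T' (opposite s) == Some T).
Proof.
by rewrite !neighbourE; case: s => /=; congr (_ && _); rewrite eq_sym.
Qed.

Lemma edge_int_opposite T s T' F : neighbour T s == Some T' ->
  edge_int T s F = edge_int T' (opposite s) F.
Proof.
rewrite neighbourE; case: s => /= /andP[/eqP e1 /eqP e2];
  by rewrite /edge_int /edge_point /edge_param/= ?e1 ?e2.
Qed.

(** The pairs (cell, interior side) are permuted by the involution that sends
    a side to the same edge viewed from the other cell. *)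
Lemma sum_neighbour_swap (f : cell M -> side -> cell M -> R) :
  \sum_T \sum_s \sum_(T' | neighbour T s == Some T') f T s T' =
  \sum_T \sum_s \sum_(T' | neighbour T s == Some T') f T' (opposite s) T.
Proof.
under eq_bigr do under eq_bigr do rewrite big_mkcond.
under eq_bigr do rewrite exchange_big.
rewrite exchange_big; apply: eq_bigr => T' _.
rewrite [RHS](eq_bigr (fun s => \sum_T
    if neighbour T' s == Some T then f T (opposite s) T' else 0)); last first.
  by move=> s _; rewrite big_mkcond.
rewrite [RHS]exchange_big; apply: eq_bigr => T _.
rewrite (reindex_inj (inv_inj oppositeK)); apply: eq_bigr => s _.
by rewrite neighbour_opposite oppositeK.
Qed.

(** A side is either a boundary edge or has exactly one neighbouring cell, so
    the sum over neighbours is a way to restrict to interior sides that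
    makes [sum_neighbour_swap] applicable. *)
Lemma sum_interior (f : cell M -> side -> R) T s :
  f T s = (if boundary_edge T s then f T s else 0)
          + \sum_(T' | neighbour T s == Some T') f T s.
Proof.
rewrite /boundary_edge; case: (neighbour T s) => [T'|]; last first.
  by rewrite big_pred0_eq addr0.
by rewrite add0r (big_pred1 T') // => T''; rewrite eq_sym.
Qed.

End Pairing.

(** * Energy identity of the upwind advection form *)

Section Advection.
Variables (R : realType) (M : mesh R) (K dv : nat) (v : 'rV[R]_dv.+2).
Implicit Types (u w phi : Uhat R M K) (T : cell M) (s : side).

Local Notation flux s := (dot2 v (normal R s)).

(** The part of [aform] that does not couple the directions, for one
    direction. *)
Definition advection u phi : R :=
  \sum_T cell_int T (fun z =>
      - dot2 v (gradient (qval (phi T)) z) * qval (u T) z)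
  + \sum_T \sum_(s | boundary_edge T s && (0 <= flux s))
      edge_int T s (fun z => flux s * qval (phi T) z * qval (u T) z)
  - \sum_T \sum_(s | flux s < 0) \sum_(T' | neighbour T s == Some T')
      edge_int T s (fun z =>
        flux s * (qval (phi T') z - qval (phi T) z) * qval (u T') z).

Lemma advectionB u w phi :
  advection (u - w) phi = advection u phi - advection w phi.
Proof.
have tq c : tame (qval c) := tame_qval (c : 'M[R]_K.+1).
rewrite /advection.
have -> : \sum_T cell_int T (fun z =>
      - dot2 v (gradient (qval (phi T)) z) * qval ((u - w) T) z) =
    \sum_T cell_int T (fun z =>
      - dot2 v (gradient (qval (phi T)) z) * qval (u T) z) -
    \sum_T cell_int T (fun z =>
      - dot2 v (gradient (qval (phi T)) z) * qval (w T) z).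
  rewrite -sumrB; apply: eq_bigr => T _; rewrite -cell_intB; last 2 first.
  - by apply/cell_integrable_tame/tameM => //; apply/tameN/tame_dot2_gradient.
  - by apply/cell_integrable_tame/tameM => //; apply/tameN/tame_dot2_gradient.
  by congr cell_int; apply/funext => z; rewrite !ffunE qvalB mulrBr.
have -> : \sum_T \sum_(s | boundary_edge T s && (0 <= flux s))
      edge_int T s (fun z => flux s * qval (phi T) z * qval ((u - w) T) z) =
    \sum_T \sum_(s | boundary_edge T s && (0 <= flux s))
      edge_int T s (fun z => flux s * qval (phi T) z * qval (u T) z) -
    \sum_T \sum_(s | boundary_edge T s && (0 <= flux s))
      edge_int T s (fun z => flux s * qval (phi T) z * qval (w T) z).
  rewrite -sumrB; apply: eq_bigr => T _; rewrite -sumrB; apply: eq_bigr => s _.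
  have t1 : tame (fun z => flux s * qval (phi T) z).
    by apply: tameM => //; exact: tame_cst.
  rewrite -edge_intB; [|exact: tameM..].
  by congr edge_int; apply/funext => z; rewrite !ffunE qvalB mulrBr.
have -> : \sum_T \sum_(s | flux s < 0) \sum_(T' | neighbour T s == Some T')
      edge_int T s (fun z =>
        flux s * (qval (phi T') z - qval (phi T) z) * qval ((u - w) T') z) =
    \sum_T \sum_(s | flux s < 0) \sum_(T' | neighbour T s == Some T')
      edge_int T s (fun z =>
        flux s * (qval (phi T') z - qval (phi T) z) * qval (u T') z) -
    \sum_T \sum_(s | flux s < 0) \sum_(T' | neighbour T s == Some T')
      edge_int T s (fun z =>
        flux s * (qval (phi T') z - qval (phi T) z) * qval (w T') z).
  rewrite -sumrB; apply: eq_bigr => T _; rewrite -sumrB; apply: eq_bigr => s _.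
  rewrite -sumrB; apply: eq_bigr => T' _.
  have t1 : tame (fun z => flux s * (qval (phi T') z - qval (phi T) z)).
    by apply: tameM; [exact: tame_cst|exact: tameB].
  rewrite -edge_intB; [|exact: tameM..].
  by congr edge_int; apply/funext => z; rewrite !ffunE qvalB mulrBr.
ring.
Qed.

(** On an interior edge with v.n < 0, seen from the downwind cell with value
    a, the upwind value being b, the volume terms of both cells give
    (v.n) (b^2 - a^2) / 2 and the upwind term gives - (v.n) (b - a) b; their
    sum is - (v.n) (b - a)^2 / 2.  On a boundary edge the volume term
    - (v.n) a^2 / 2 has the right sign on the inflow part, and changes sign
    on the outflow part when the outflow term (v.n) a^2 is added. *)
Lemma advection_energy u :
  advection u u =
  \sum_T \sum_(s | boundary_edge T s)
    2^-1 * `|flux s| * edge_int T s (fun z => qval (u T) z ^+ 2)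
  + \sum_T \sum_(s | flux s < 0) \sum_(T' | neighbour T s == Some T')
    2^-1 * `|flux s|
      * edge_int T s (fun z => (qval (u T') z - qval (u T) z) ^+ 2).
Proof.
have tq c : tame (qval c) := tame_qval (c : 'M[R]_K.+1).
have tq2 c : tame (fun z => qval (c : 'M[R]_K.+1) z ^+ 2) by apply: tameX.
pose e T s := edge_int T s (fun z => qval (u T) z ^+ 2).
pose down T s := 2^-1 * (if 0 < flux s then flux s else 0) * e T s.
pose up T s := 2^-1 * (if flux s < 0 then flux s else 0) * e T s.
(* The interior sides with v.n > 0 are moved to the neighbouring cell, where
   v.n < 0 and the trace to be integrated is the one from the neighbour. *)
have swap : \sum_T \sum_s \sum_(T' | neighbour T s == Some T') down T s =
    \sum_T \sum_(s | flux s < 0) \sum_(T' | neighbour T s == Some T')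
      - (2^-1 * flux s * edge_int T s (fun z => qval (u T') z ^+ 2)).
  rewrite sum_neighbour_swap; apply: eq_bigr => T _; rewrite [RHS]big_mkcond.
  apply: eq_bigr => s _; case: ifPn => fs.
    apply: eq_bigr => T' nb; rewrite /down /e dot2_opposite oppr_gt0 fs.
    by rewrite -(edge_int_opposite _ nb); ring.
  by apply: big1 => T' _; rewrite /down dot2_opposite oppr_gt0 (negbTE fs); ring.
have upI : \sum_T \sum_s \sum_(T' | neighbour T s == Some T') up T s =
    \sum_T \sum_(s | flux s < 0) \sum_(T' | neighbour T s == Some T')
      2^-1 * flux s * e T s.
  apply: eq_bigr => T _; rewrite [RHS]big_mkcond.
  apply: eq_bigr => s _; rewrite /up; case: ifPn => fs //.
  by apply: big1 => T' _; ring.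
have vol : \sum_T cell_int T (fun z =>
      - dot2 v (gradient (qval (u T)) z) * qval (u T) z) =
    - \sum_T \sum_(s | boundary_edge T s) 2^-1 * flux s * e T s
    - \sum_T \sum_(s | flux s < 0) \sum_(T' | neighbour T s == Some T')
      2^-1 * flux s * e T s
    - \sum_T \sum_(s | flux s < 0) \sum_(T' | neighbour T s == Some T')
      - (2^-1 * flux s * edge_int T s (fun z => qval (u T') z ^+ 2)).
  rewrite -swap -upI -!opprD -!big_split -sumrN; apply: eq_bigr => T _ /=.
  rewrite Green -/(e T _); congr (- _).
  rewrite [X in X + _ + _]big_mkcond -!big_split; apply: eq_bigr => s _ /=.
  rewrite {1}(sum_interior (fun T s => 2^-1 * flux s * e T s)) -addrA; congr (_ + _).
  rewrite -big_split; apply: eq_bigr => T' _ /=; rewrite /up /down.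
  by case: ltgtP => [_|_|->]; ring.
have out : \sum_T \sum_(s | boundary_edge T s && (0 <= flux s))
      edge_int T s (fun z => flux s * qval (u T) z * qval (u T) z) =
    \sum_T \sum_(s | boundary_edge T s)
      (if 0 <= flux s then flux s else 0) * e T s.
  apply: eq_bigr => T _; rewrite big_mkcondr; apply: eq_bigr => s _.
  case: ifP => _; last by rewrite mul0r.
  rewrite /e -edge_intZ//; congr edge_int; apply/funext => z; ring.
have jumpE T s T' : edge_int T s (fun z =>
        flux s * (qval (u T') z - qval (u T) z) * qval (u T') z) =
    2^-1 * flux s * (edge_int T s (fun z => (qval (u T') z - qval (u T) z) ^+ 2)
     + edge_int T s (fun z => qval (u T') z ^+ 2) - e T s).
  (* (b - a) b = ((b - a)^2 + b^2 - a^2) / 2 *)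
  have tB : tame (fun z => (qval (u T') z - qval (u T) z) ^+ 2).
    by apply/tameX/tameB.
  rewrite /e -edge_intD// -edge_intB//; last exact: tameD.
  rewrite -edge_intZ; last by apply: tameB => //; exact: tameD.
  by congr edge_int; apply/funext => z; field.
rewrite /advection vol out.
rewrite -!addrA; set I1 := \sum_T _; set I2 := \sum_T _.
have -> : \sum_T \sum_(s | boundary_edge T s)
      2^-1 * `|flux s| * edge_int T s (fun z => qval (u T) z ^+ 2) =
    \sum_T \sum_(s | boundary_edge T s)
      (if 0 <= flux s then flux s else 0) * e T s - I1.
  rewrite /I1 -sumrB; apply: eq_bigr => T _; rewrite -sumrB; apply: eq_bigr => s _.
  by rewrite -/(e T s); case: ger0P => _; field.
have -> : \sum_T \sum_(s | flux s < 0) \sum_(T' | neighbour T s == Some T')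
    2^-1 * `|flux s|
      * edge_int T s (fun z => (qval (u T') z - qval (u T) z) ^+ 2) =
   - I2
    - \sum_T \sum_(s | flux s < 0) \sum_(T' | neighbour T s == Some T')
      - (2^-1 * flux s * edge_int T s (fun z => qval (u T') z ^+ 2))
    - \sum_T \sum_(s | flux s < 0) \sum_(T' | neighbour T s == Some T')
      edge_int T s (fun z =>
        flux s * (qval (u T') z - qval (u T) z) * qval (u T') z).
  rewrite /I2 -!opprD -!big_split -sumrN; apply: eq_bigr => T _ /=.
  rewrite -!big_split -sumrN; apply: eq_bigr => s fs /=.
  rewrite -!big_split -sumrN; apply: eq_bigr => T' _ /=.
  rewrite jumpE ltr0_norm//; ring.
ring.
Qed.

Lemma advection_ge0 u : 0 <= advection u u.
Proof.
have h (a b : R) : 0 <= b -> 0 <= 2^-1 * `|a| * b.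
  by move=> b0; rewrite !mulr_ge0// invr_ge0.
rewrite advection_energy addr_ge0// sumr_ge0// => T _.
  by rewrite sumr_ge0// => s _; apply/h/edge_int_ge0 => z; exact: sqr_ge0.
rewrite sumr_ge0// => s _; rewrite sumr_ge0// => T' _.
by apply/h/edge_int_ge0 => z; exact: sqr_ge0.
Qed.

End Advection.

(** * The inner product, collisions and coercivity *)

Section CellSums.
Variables (R : realType) (M : mesh R) (I : Type).
Implicit Types (T : cell M) (F : I -> R * R -> R).

Lemma cell_integrable_sum T (r : seq I) F : (forall i, cell_integrable T (F i)) ->
  cell_integrable T (fun z => \sum_(i <- r) F i z).
Proof.
move=> iF; elim: r => [|i r IH].
  by under eq_fun do rewrite big_nil; apply/cell_integrable_tame/tame_cst.
under eq_fun do rewrite big_cons.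
exact: cell_integrableD.
Qed.

Lemma cell_int_sum T (r : seq I) F : (forall i, cell_integrable T (F i)) ->
  cell_int T (fun z => \sum_(i <- r) F i z) = \sum_(i <- r) cell_int T (F i).
Proof.
move=> iF; elim: r => [|i r IH].
  rewrite big_nil -[RHS](mul0r (cell_int T (fun=> 0))) -cell_intZ; last first.
    by apply/cell_integrable_tame/tame_cst.
  by congr cell_int; apply/funext => z; rewrite big_nil mul0r.
rewrite big_cons -IH -cell_intD//; last exact: cell_integrable_sum.
by congr cell_int; apply/funext => z; rewrite big_cons.
Qed.

End CellSums.

Section Collision.
Variables (R : realType) (M : mesh R) (K dv Nv : nat) (Q : quadrature R dv Nv).
Implicit Types (f g phi : Uh R M K Nv) (T : cell M) (z : R * R).

Lemma hinnerE f g : hinner Q f g =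
  \sum_T cell_int T (fun z => \sum_j weight Q j * (qval (f j T) z * qval (g j T) z)).
Proof.
have i1 T j : cell_integrable T (fun z => qval (f j T) z * qval (g j T) z).
  by apply/cell_integrable_tame/tameM; exact: tame_qval.
rewrite /hinner /L2inner; under eq_bigr do rewrite mulr_sumr.
rewrite exchange_big; apply: eq_bigr => T _; rewrite cell_int_sum => [|j].
  by apply: eq_bigr => j _; rewrite cell_intZ.
apply/cell_integrable_tame/tameM; first exact: tame_cst.
by apply: tameM; exact: tame_qval.
Qed.

Lemma hinner_integrable f g T : cell_integrable T
  (fun z => \sum_j weight Q j * (qval (f j T) z * qval (g j T) z)).
Proof.
apply: cell_integrable_sum => j.
apply/cell_integrable_tame/tameM; first exact: tame_cst.
by apply: tameM; exact: tame_qval.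
Qed.

Lemma hinner_ge0 f : 0 <= hinner Q f f.
Proof.
rewrite hinnerE sumr_ge0// => T _; apply: cell_int_ge0 => z _.
by rewrite sumr_ge0// => j _; rewrite mulr_ge0 ?sqr_ge0// ltW// weight_gt0.
Qed.

(** The expansion that replaces the Cauchy-Schwarz inequality in the final
    estimate. *)
Lemma hinner_subZ f g (k : R) :
  hinner Q (f - k *: g) (f - k *: g) =
  hinner Q f f - (2 * k) * hinner Q f g + k ^+ 2 * hinner Q g g.
Proof.
rewrite !hinnerE 2!mulr_sumr -sumrB -big_split; apply: eq_bigr => T _ /=.
have tH (u w : Uh R M K Nv) k' : cell_integrable T
    (fun z => k' * \sum_j weight Q j * (qval (u j T) z * qval (w j T) z)).
  by apply: cell_integrableZ; exact: hinner_integrable.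
rewrite -!cell_intZ; [|exact: hinner_integrable..].
rewrite -cell_intB; [|exact: hinner_integrable|exact: tH].
rewrite -cell_intD; last 2 first.
- by apply: cell_integrableB; [exact: hinner_integrable|exact: tH].
- exact: tH.
congr cell_int; apply/funext => z.
rewrite !mulr_sumr -sumrB -big_split; apply: eq_bigr => j _ /=.
by rewrite !ffunE qvalB qvalZ; ring.
Qed.

Lemma hnormN f : hnorm Q (- f) = hnorm Q f.
Proof.
congr Num.sqrt; apply: eq_bigr => j _; congr (_ * _); apply: eq_bigr => T _.
have qN z : qval ((- f) j T) z = - qval (f j T) z.
  by rewrite !ffunE -scaleN1r qvalZ mulN1r.
by congr cell_int; apply/funext => z; rewrite qN mulrNN.
Qed.

Variables (d : nat) (D : rte_data R d dv) (mu : 'rV[R]_d.+1).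

(** The integrand of the part of [aform] that couples the directions. *)
Definition collision f phi T z : R :=
  \sum_j weight Q j * (sigma_t D z mu * qval (phi j T) z * qval (f j T) z
                       - sigma_s D z mu * density Q f T z * qval (phi j T) z).

Section Integrable.
Hypothesis hs :
  (lebesgue2 R).-integrable (domain M) (EFin \o (fun z => sigma_s D z mu)).
Hypothesis ha :
  (lebesgue2 R).-integrable (domain M) (EFin \o (fun z => sigma_a D z mu)).

Lemma tame_density f T : tame (density Q f T).
Proof.
by apply: tame_sum => j; apply: tameM; [exact: tame_cst|exact: tame_qval].
Qed.

Let sigma_s_cell T : cell_integrable T (fun z => sigma_s D z mu).
Proof. exact: cell_integrable_domain. Qed.

Let sigma_t_cell T : cell_integrable T (fun z => sigma_t D z mu).
Proof. by apply: cell_integrableD => //; exact: cell_integrable_domain. Qed.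

Let removal_cell f phi T j : cell_integrable T
  (fun z => sigma_t D z mu * qval (phi j T) z * qval (f j T) z).
Proof. by do 2 (apply: cell_integrableM; last exact: tame_qval). Qed.

Let scatter_cell f phi T j : cell_integrable T
  (fun z => sigma_s D z mu * density Q f T z * qval (phi j T) z).
Proof.
apply: cell_integrableM; last exact: tame_qval.
by apply: cell_integrableM; last exact: tame_density.
Qed.

Let gain_loss_cell f phi T j : cell_integrable T (fun z =>
  weight Q j * (sigma_t D z mu * qval (phi j T) z * qval (f j T) z
                - sigma_s D z mu * density Q f T z * qval (phi j T) z)).
Proof.
apply: cell_integrableZ; apply: cell_integrableB; [exact: removal_cell|exact: scatter_cell].
Qed.

Lemma collision_integrable f phi T : cell_integrable T (collision f phi T).
Proof. by apply: cell_integrable_sum => j; exact: gain_loss_cell. Qed.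

Lemma aformE f phi : aform Q D mu f phi =
  \sum_j weight Q j * advection (vnode Q j) (f j) (phi j)
  + \sum_T cell_int T (collision f phi T).
Proof.
have -> : \sum_T cell_int T (collision f phi T) =
    \sum_j weight Q j * (\sum_T cell_int T (fun z =>
       sigma_t D z mu * qval (phi j T) z * qval (f j T) z)
     - \sum_T cell_int T (fun z =>
       sigma_s D z mu * density Q f T z * qval (phi j T) z)).
  under [RHS]eq_bigr do rewrite -sumrB mulr_sumr.
  rewrite [RHS]exchange_big; apply: eq_bigr => T _.
  rewrite /collision cell_int_sum => [|j]; last exact: gain_loss_cell.
  apply: eq_bigr => j _; rewrite -cell_intB; [|exact: removal_cell|exact: scatter_cell].
  by rewrite cell_intZ//; apply: cell_integrableB; [exact: removal_cell|exact: scatter_cell].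
rewrite -big_split; apply: eq_bigr => j _ /=; rewrite -mulrDr; congr (_ * _).
have -> : \sum_T cell_int T (fun z =>
    - dot2 (vnode Q j) (gradient (qval (phi j T)) z) * qval (f j T) z
    + sigma_t D z mu * qval (phi j T) z * qval (f j T) z) =
  \sum_T cell_int T (fun z =>
    - dot2 (vnode Q j) (gradient (qval (phi j T)) z) * qval (f j T) z)
  + \sum_T cell_int T (fun z =>
       sigma_t D z mu * qval (phi j T) z * qval (f j T) z).
  rewrite -big_split; apply: eq_bigr => T _ /=; rewrite cell_intD//.
  apply/cell_integrable_tame/tameM; last exact: tame_qval.
  exact/tameN/tame_dot2_gradient.
rewrite /advection; ring.
Qed.

Lemma densityB f g T z : density Q (f - g) T z = density Q f T z - density Q g T z.
Proof.
by rewrite /density -sumrB; apply: eq_bigr => j _; rewrite !ffunE qvalB mulrBr.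
Qed.

Lemma aformB f g phi :
  aform Q D mu (f - g) phi = aform Q D mu f phi - aform Q D mu g phi.
Proof.
have -> : aform Q D mu (f - g) phi =
    (\sum_j weight Q j * advection (vnode Q j) (f j) (phi j)
     - \sum_j weight Q j * advection (vnode Q j) (g j) (phi j))
    + (\sum_T cell_int T (collision f phi T)
       - \sum_T cell_int T (collision g phi T)).
  rewrite aformE -!sumrB; congr (_ + _).
    by apply: eq_bigr => j _; rewrite !ffunE advectionB mulrBr.
  apply: eq_bigr => T _; rewrite -cell_intB; [|exact: collision_integrable..].
  congr cell_int; apply/funext => z; rewrite /collision -sumrB.
  by apply: eq_bigr => j _; rewrite !ffunE densityB qvalB; ring.
rewrite !aformE; ring.
Qed.

(** Jensen's inequality: the difference of the two sides is the variance of
    the angular values, as the weights sum to one. *)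
Lemma density_sqr_le f T z :
  density Q f T z ^+ 2 <= \sum_j weight Q j * qval (f j T) z ^+ 2.
Proof.
have rhoE : \sum_j weight Q j * qval (f j T) z = density Q f T z by [].
move: (density Q f T z) rhoE => rho rhoE; rewrite -subr_ge0.
have -> : \sum_j weight Q j * qval (f j T) z ^+ 2 - rho ^+ 2 =
    \sum_j weight Q j * (qval (f j T) z - rho) ^+ 2.
  have -> : rho ^+ 2 = 2 * rho * (\sum_j weight Q j * qval (f j T) z)
                       - rho ^+ 2 * \sum_j weight Q j.
    by rewrite weight_sum1 rhoE; ring.
  rewrite !mulr_sumr -!sumrB.
  by apply: eq_bigr => j _; ring.
by apply: sumr_ge0 => j _; rewrite mulr_ge0 ?sqr_ge0// ltW// weight_gt0.
Qed.

(** With u_j the angular values and rho their mean, the collision integrand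
    equals sigma_a sum_j w_j u_j^2 + sigma_s (sum_j w_j u_j^2 - rho^2). *)
Lemma collision_ge f T z (s : R) :
  0 <= sigma_s D z mu -> s <= sigma_a D z mu ->
  s * \sum_j weight Q j * (qval (f j T) z * qval (f j T) z)
    <= collision f f T z.
Proof.
move=> s0 sa.
have -> : collision f f T z =
    sigma_a D z mu * \sum_j weight Q j * qval (f j T) z ^+ 2
    + sigma_s D z mu * (\sum_j weight Q j * qval (f j T) z ^+ 2
                        - density Q f T z ^+ 2).
  have -> : density Q f T z ^+ 2 =
      \sum_j weight Q j * (density Q f T z * qval (f j T) z).
    rewrite expr2 {2}/density mulr_sumr; apply: eq_bigr => j _; ring.
  rewrite -sumrB !mulr_sumr -big_split; apply: eq_bigr => j _ /=.
  rewrite /sigma_t; ring.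
rewrite -[leLHS]addr0 lerD// ?mulr_ge0 ?subr_ge0 ?density_sqr_le//.
rewrite ler_wpM2r//; apply: sumr_ge0 => j _.
by rewrite mulr_ge0 ?sqr_ge0// ltW// weight_gt0.
Qed.

Lemma aform_coercive f (s : R) :
  (forall z, domain M z -> 0 <= sigma_s D z mu) ->
  (forall z, domain M z -> s <= sigma_a D z mu) ->
  s * hinner Q f f <= aform Q D mu f f.
Proof.
move=> s0 sa; rewrite aformE hinnerE -[leLHS]add0r lerD//.
  apply: sumr_ge0 => j _; rewrite mulr_ge0 ?advection_ge0// ltW//.
  exact: weight_gt0.
rewrite mulr_sumr; apply: ler_sum => T _; rewrite -cell_intZ; last first.
  exact: hinner_integrable.
rewrite -subr_ge0 -cell_intB; last 2 first.
- exact: collision_integrable.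
- by apply: cell_integrableZ; exact: hinner_integrable.
apply: cell_int_ge0 => z /cell_sub_domain zD.
by rewrite subr_ge0 collision_ge ?s0 ?sa.
Qed.

End Integrable.

End Collision.

(** * The a posteriori error bound *)

Lemma sigma_a_star_le (R : realType) (d dv Nv : nat) (M : mesh R)
    (Q : quadrature R dv Nv) (P : set 'rV[R]_d.+1) (D : rte_data R d dv) z mu :
  admissible M Q P D -> domain M z -> P mu ->
  sigma_a_star M P D <= sigma_a D z mu.
Proof.
move=> hD zD muP; apply: ge_inf; last by exists z => //; exists mu.
by exists 0 => _ [z' z'D [mu' mu'P <-]]; exact: (sigma_a_ge0 hD).
Qed.

Theorem proposition1 (R : realType) (d dv K Nv m : nat) (M : mesh R)
    (Q : quadrature R dv Nv) (P : set 'rV[R]_d.+1) (hP : compact P)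
    (D : rte_data R d dv) (hD : admissible M Q P D)
    (fh : 'rV[R]_d.+1 -> Uh R M K Nv)
    (hfh : forall mu, P mu -> full_order_solution Q D mu (fh mu))
    (r : 'rV[R]_d.+1 -> Uh R M K Nv -> Uh R M K Nv)
    (hr : forall mu g, P mu -> is_residual Q D mu g (r mu g))
    (mus : m.-tuple 'rV[R]_d.+1) (hmus : forall i : 'I_m, P (tnth mus i))
    (hfree : free (map fh mus))
    (hsigma : 0 < sigma_a_star M P D)
    (mu : 'rV[R]_d.+1) (hmu : P mu) (fRB : Uh R M K Nv)
    (hRB : galerkin_solution Q D mu <<map fh mus>>%VS fRB \/
           lspg_solution Q (r mu) <<map fh mus>>%VS fRB) :
  hnorm Q (fh mu - fRB) <= 1 / sigma_a_star M P D * hnorm Q (r mu fRB) /\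
  1 / sigma_a_star M P D * hnorm Q (r mu fRB) =
    error_indicator Q (r mu) fRB / sigma_a_star M P D.
Proof.
split; last by rewrite /error_indicator mul1r mulrC.
(* With this sign of e, rho represents a(fRB, .) - l = a(e, .). *)
set s := sigma_a_star M P D; set e := fRB - fh mu; set rho := r mu fRB.
have re : hinner Q rho e = aform Q D mu e e.
  rewrite (hr mu fRB hmu e) -(hfh mu hmu e) /e -aformB//.
    exact: (sigma_s_int hD hmu).
  exact: (sigma_a_int hD hmu).
have coe : s * hinner Q e e <= hinner Q rho e.
  rewrite re; apply: aform_coercive.
  - exact: (sigma_s_int hD hmu).
  - exact: (sigma_a_int hD hmu).
  - by move=> z zD; exact: (sigma_s_ge0 hD).
  - by move=> z zD; exact: (sigma_a_star_le hD).
have key : s ^+ 2 * hinner Q e e <= hinner Q rho rho.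
  have := hinner_ge0 Q (rho - s *: e); rewrite hinner_subZ.
  have : s * (s * hinner Q e e) <= s * hinner Q rho e by rewrite ler_pM2l.
  lra.
have -> : hnorm Q (fh mu - fRB) = hnorm Q e by rewrite -hnormN opprB.
rewrite mul1r mulrC ler_pdivlMr// mulrC /hnorm.
rewrite -(ler_pXn2r (ltn0Sn 1)) ?nnegrE ?mulr_ge0 ?sqrtr_ge0//; last exact: ltW.
by rewrite exprMn !sqr_sqrtr ?hinner_ge0.
Qed.
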